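(* Let $(\Omega,d)$ be a strongly finite-dimensional $*$-differential calculus of dimension $N$ over the Hopf $*$-algebra $\mathcal{A}$ associated to a compact quantum group $G$, with $\dim(\Omega^{\mathrm{inv}}_N)=1$ and $d(\Omega^{\mathrm{inv}}_{N-1})=0$, and fix a graded, left-invariant inner product on $\Omega$. Let $\omega_1,\dots,\omega_M$ be an orthonormal basis of $\Omega_1^{\mathrm{inv}}$, let $\chi_1,\dots,\chi_M$ be the linear functionals on $\mathcal{A}$ with $da=\sum_{r}(\chi_r*a)\omega_r$ for all $a\in\mathcal{A}$, and set $\chi=\sum_{r=1}^M\chi_r^*\chi_r$. Let $(U^\alpha)_\alpha$ be a complete family of mutually inequivalent irreducible unitary representations of $G$, with $U^\alpha$ acting on the Hilbert space $H_\alpha$ of dimension $N_\alpha$. Let $T^\alpha=(\mathrm{id}\otimes\chi)(U^\alpha)\in B(H_\alpha)$. Choose an orthonormal basis $e^\alpha_1,\dots,e^\alpha_{N_\alpha}$ of $H_\alpha$ making $T^\alpha$ diagonal, so that $T^\alpha e^\alpha_i=\lambda^\alpha_ie^\alpha_i$ for some $\lambda_i^\alpha\in\mathbb{C}$. Let $U^\alpha_{ij}$ be the matrix elements of $U^\alpha$ relative to this basis. Then $\nabla U^\alpha_{ij}=\lambda^\alpha_jU^\alpha_{ij}$.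
   Context: All spaces are over $\mathbb{C}$; inner products are linear in the first variable. $G=(A,\Delta)$ is a compact quantum group in the sense of Woronowicz. Its associated Hopf $*$-algebra $\mathcal{A}$ is the linear span of the matrix elements of all finite-dimensional irreducible unitary representations of $G$, with the restriction of $\Delta$; $\kappa$ is its co-inverse (antipode), and $h$ its (positive, faithful) Haar integral. A unitary representation $U^\alpha\in B(H_\alpha)\otimes\mathcal{A}$ has matrix elements satisfying $\Delta(U^\alpha_{ij})=\sum_kU^\alpha_{ik}\otimes U^\alpha_{kj}$; $(\mathrm{id}\otimes\chi)(U^\alpha)$ is the operator with matrix $(\chi(U^\alpha_{ij}))$. The operator $T^\alpha$ is positive, hence diagonalisable in an orthonormal basis. A graded $*$-algebra is an algebra $\Omega=\bigoplus_{n\ge 0}\Omega_n$ with $\Omega_m\Omega_n\subseteq\Omega_{m+n}$ and a conjugate-linear degree-zero map $\omega\mapsto\omega^*$ with $(\omega^* )^*=\omega$ and $(\omega_1\omega_2)^*=(-1)^{kl}\omega_2^*\omega_1^*$ for $\omega_1\in\Omega_k,\omega_2\in\Omega_l$. A graded $*$-differential algebra is a pair $(\Omega,d)$ with $\Omega$ a graded $*$-algebra and $d$ a linear map of degree $1$ with $d^2=0$, $d(\omega^* )=(d\omega)^*$ and $d(\omega'\omega)=d(\omega')\omega+(-1)^k\omega'd\omega$ for $\omega'\in\Omega_k$. A $*$-differential calculus over $\mathcal{A}$ is a graded $*$-differential algebra $(\Omega,d)$ such that: (1) $\Omega_0=\mathcal{A}$ as $*$-algebras and $\Omega_k$ ($k>0$)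 is the linear span of products $a_0\,da_1\cdots da_k$, $a_i\in\mathcal{A}$; (2) there is an algebra homomorphism $\Delta_\Omega:\Omega\to\mathcal{A}\otimes\Omega$ extending $\Delta$ with $(\mathrm{id}_{\mathcal{A}}\otimes d)\Delta_\Omega=\Delta_\Omega d$; (3) $d1=0$. $\Omega^{\mathrm{inv}}=\{\omega:\Delta_\Omega(\omega)=1\otimes\omega\}$, $\Omega^{\mathrm{inv}}_k=\Omega_k\cap\Omega^{\mathrm{inv}}$; $a\otimes\omega\mapsto a\omega$ is an isomorphism of left $\mathcal{A}$-modules $\mathcal{A}\otimes\Omega^{\mathrm{inv}}\to\Omega$. The calculus is strongly finite dimensional if $\dim\Omega^{\mathrm{inv}}<\infty$; its dimension is the $N$ with $\Omega_N\ne0$, $\Omega_k=0$ for $k>N$. An inner product on $\Omega$ is graded if the $\Omega_k$ are pairwise orthogonal, and left-invariant if $(a\omega\mid b\eta)=h(b^*a)(\omega\mid\eta)$ for $a,b\in\mathcal{A}$, $\omega,\eta\in\Omega^{\mathrm{inv}}$; it is normalised so that $(1\mid1)=1$, i.e. $(a\mid b)=h(b^*a)$ on $\Omega_0=\mathcal{A}$. Then $d$ has an adjoint $d^*$ on $\Omega$, and the Laplacian is $\nabla=(d+d^* )^2=dd^*+d^*d$. For linear functionals $f,g,\chi$ on $\mathcal{A}$: $\chi*a=(\mathrm{id}\otimes\chi)\Delta(a)$, $(fg)(a)=(f\otimes g)\Delta(a)$, $\chi^*(a)=\overline{\chi(\kappa(a)^* )}$. *)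

(* Defs.v *)
From HB Require Import structures.
From mathcomp Require Import all_boot all_order all_algebra.
From mathcomp Require Import generic_quotient sesquilinear complex.
From mathcomp Require Import boolp classical_sets reals.

Set Implicit Arguments.
Unset Strict Implicit.
Unset Printing Implicit Defensive.

Import Order.TTheory GRing.Theory Num.Theory.
Local Open Scope classical_set_scope.
Local Open Scope ring_scope.
Local Open Scope quotient_scope.

(* The algebraic tensor product of modules over a commutative ring: formal    *)
(* sums of pairs, two of them being identified when every balanced biadditive *)
(* map to an abelian group takes the same value on both.                      *)

Section TensorProduct.
Variables (K : comNzRingType) (V W : lmodType K).

Definition balanced (X : zmodType) (f : V -> W -> X) : Prop :=
  [/\ forall w, zmod_morphism (f^~ w),
      forall v, zmod_morphism (f v)
    & forall a v w, f (a *: v) w = f v (a *: w)].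

Definition fsum (X : zmodType) (f : V -> W -> X) (s : seq (V * W)) : X :=
  \sum_(p <- s) f p.1 p.2.

Definition tensor_rel (s t : seq (V * W)) : bool :=
  `[< forall (X : zmodType) (f : V -> W -> X), balanced f ->
        fsum f s = fsum f t >].

Lemma tensor_rel_refl : reflexive tensor_rel.
Proof. by move=> s; apply/asboolP. Qed.

Lemma tensor_rel_sym : symmetric tensor_rel.
Proof. by move=> s t; apply/asboolP/asboolP => st X f bf; rewrite st. Qed.

Lemma tensor_rel_trans : transitive tensor_rel.
Proof.
move=> t s u /asboolP st /asboolP tu; apply/asboolP => X f bf.
by rewrite st // tu.
Qed.

Canonical tensor_equiv :=
  EquivRel tensor_rel tensor_rel_refl tensor_rel_sym tensor_rel_trans.

Definition tensor := {eq_quot tensor_equiv}.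
HB.instance Definition _ := Choice.on tensor.
HB.instance Definition _ := EqQuotient.on tensor.

Definition tens (v : V) (w : W) : tensor := \pi_tensor [:: (v, w)].

(* The map induced by f on the tensor product: meaningful for balanced f,     *)
(* in particular for f linear, or conjugate-linear, in both variables.        *)
Definition tlift (X : zmodType) (f : V -> W -> X) (x : tensor) : X :=
  fsum f (repr x).

Lemma tensorP (s t : seq (V * W)) :
  (forall (X : zmodType) (f : V -> W -> X), balanced f ->
     fsum f s = fsum f t) ->
  \pi_tensor s = \pi_tensor t.
Proof. by move=> st; apply/eqmodP/asboolP. Qed.

Lemma tlift_pi (X : zmodType) (f : V -> W -> X) (s : seq (V * W)) :
  balanced f -> tlift f (\pi_tensor s) = fsum f s.
Proof.
move=> bf; rewrite /tlift; case: piP => t /eqmodP /asboolP st.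
by rewrite st.
Qed.

Lemma balanced0 (X : zmodType) (f : V -> W -> X) w : balanced f -> f 0 w = 0.
Proof. by case=> fl _ _; have := fl w 0 0; rewrite !subrr. Qed.

Lemma balancedN (X : zmodType) (f : V -> W -> X) v w :
  balanced f -> f (- v) w = - f v w.
Proof.
move=> bf; have [fl _ _] := bf; have := fl w 0 v.
by rewrite !sub0r (balanced0 _ bf) sub0r.
Qed.

Lemma balancedDl (X : zmodType) (f : V -> W -> X) v v' w :
  balanced f -> f (v + v') w = f v w + f v' w.
Proof.
move=> bf; have [fl _ _] := bf; have := fl w v (- v').
by rewrite opprK => ->; rewrite (balancedN _ _ bf) opprK.
Qed.

Lemma balancedDr (X : zmodType) (f : V -> W -> X) v w w' :
  balanced f -> f v (w + w') = f v w + f v w'.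
Proof.
move=> bf; have [_ fr _] := bf.
have f0 : f v 0 = 0 by have := fr v 0 0; rewrite !subrr.
have := fr v w (- w'); rewrite opprK => ->; congr (_ + _).
by have := fr v 0 w'; rewrite !sub0r f0 sub0r => ->; rewrite opprK.
Qed.

Lemma balancedZ (X : zmodType) (f : V -> W -> X) (a : K) :
  balanced f -> balanced (fun v w => f (a *: v) w).
Proof.
move=> [fl fr fb]; split=> [w v v'|v w w'|b v w]; rewrite ?scalerBr //.
- exact: fl.
- exact: fr.
- by rewrite scalerA mulrC -scalerA fb.
Qed.

Definition tzero : tensor := \pi_tensor [::].
Definition tadd (x y : tensor) : tensor := \pi_tensor (repr x ++ repr y).
Definition tscale (a : K) (x : tensor) : tensor :=
  \pi_tensor [seq (a *: p.1, p.2) | p <- repr x].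
Definition topp (x : tensor) : tensor := tscale (- 1) x.

Lemma fsum_cat (X : zmodType) (f : V -> W -> X) s t :
  fsum f (s ++ t) = fsum f s + fsum f t.
Proof. by rewrite /fsum big_cat. Qed.

Lemma fsum_scale (X : zmodType) (f : V -> W -> X) a s :
  fsum f [seq (a *: p.1, p.2) | p <- s] = fsum (fun v w => f (a *: v) w) s.
Proof. by rewrite /fsum big_map. Qed.

Lemma tliftD (X : zmodType) (f : V -> W -> X) x y :
  balanced f -> tlift f (tadd x y) = tlift f x + tlift f y.
Proof. by move=> bf; rewrite tlift_pi // fsum_cat. Qed.

Lemma tlift_scale (X : zmodType) (f : V -> W -> X) a x :
  balanced f -> tlift f (tscale a x) = tlift (fun v w => f (a *: v) w) x.
Proof. by move=> bf; rewrite tlift_pi // fsum_scale. Qed.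

Lemma tlift_zero (X : zmodType) (f : V -> W -> X) :
  balanced f -> tlift f tzero = 0.
Proof. by move=> bf; rewrite tlift_pi // /fsum big_nil. Qed.

Lemma tensor_ext (x y : tensor) :
  (forall (X : zmodType) (f : V -> W -> X), balanced f ->
     tlift f x = tlift f y) -> x = y.
Proof. by move=> xy; rewrite -[x]reprK -[y]reprK; apply: tensorP. Qed.

Lemma taddA : associative tadd.
Proof. by move=> x y z; apply: tensor_ext => X f bf; rewrite !tliftD // addrA. Qed.

Lemma taddC : commutative tadd.
Proof. by move=> x y; apply: tensor_ext => X f bf; rewrite !tliftD // addrC. Qed.

Lemma tadd0 : left_id tzero tadd.
Proof.
by move=> x; apply: tensor_ext => X f bf; rewrite tliftD // tlift_zero // add0r.
Qed.

Lemma taddN : left_inverse tzero topp tadd.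
Proof.
move=> x; apply: tensor_ext => X f bf.
rewrite tliftD // tlift_zero // tlift_scale // /tlift /fsum -big_split /=.
by apply: big1 => p _; rewrite scaleN1r balancedN // addNr.
Qed.

HB.instance Definition _ :=
  GRing.isZmodule.Build tensor taddA taddC tadd0 taddN.

Lemma tscaleA a b x : tscale a (tscale b x) = tscale (a * b) x.
Proof.
apply: tensor_ext => X f bf.
rewrite !tlift_scale //; last exact: balancedZ.
by rewrite /tlift /fsum; apply: eq_bigr => p _; rewrite scalerA.
Qed.

Lemma tscale1 : left_id 1 tscale.
Proof.
move=> x; apply: tensor_ext => X f bf; rewrite tlift_scale //.
by rewrite /tlift /fsum; apply: eq_bigr => p _; rewrite scale1r.
Qed.

Lemma tscaleDr : right_distributive tscale +%R.
Proof.
move=> a x y; apply: tensor_ext => X f bf.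
have bZ := balancedZ a bf.
by rewrite tlift_scale // -![_ + _]/(tadd _ _) !tliftD // !tlift_scale.
Qed.

Lemma tscaleDl x : {morph tscale^~ x : a b / a + b}.
Proof.
move=> a b; apply: tensor_ext => X f bf.
rewrite -[in RHS]/(tadd _ _) tliftD // !tlift_scale // /tlift /fsum -big_split /=.
by apply: eq_bigr => p _; rewrite scalerDl balancedDl.
Qed.

HB.instance Definition _ :=
  GRing.Zmodule_isLmodule.Build K tensor tscaleA tscale1 tscaleDr tscaleDl.

Lemma tlift_tens (X : zmodType) (f : V -> W -> X) v w :
  balanced f -> tlift f (tens v w) = f v w.
Proof. by move=> bf; rewrite tlift_pi // /fsum big_seq1. Qed.

Lemma tlift_add (X : zmodType) (f : V -> W -> X) (x y : tensor) :
  balanced f -> tlift f (x + y) = tlift f x + tlift f y.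
Proof. exact: tliftD. Qed.

Lemma tensZl a v w : tens (a *: v) w = a *: tens v w.
Proof.
apply: tensor_ext => X f bf; rewrite tlift_tens // [RHS]tlift_scale //.
by rewrite tlift_tens //; exact: balancedZ.
Qed.

Lemma tensZr a v w : tens v (a *: w) = a *: tens v w.
Proof.
rewrite -tensZl; apply: tensor_ext => X f bf.
by have [_ _ fb] := bf; rewrite !tlift_tens.
Qed.

Lemma tensDl v v' w : tens (v + v') w = tens v w + tens v' w.
Proof.
apply: tensor_ext => X f bf.
by rewrite tlift_add // !tlift_tens // balancedDl.
Qed.

Lemma tensDr v w w' : tens v (w + w') = tens v w + tens v w'.
Proof.
apply: tensor_ext => X f bf.
by rewrite tlift_add // !tlift_tens // balancedDr.
Qed.

End TensorProduct.

Notation "V ⊗ W" := (tensor V%type W%type)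
  (at level 40, left associativity) : type_scope.
Notation "v ⊗ w" := (tens v w) (at level 40, left associativity) : ring_scope.

Definition tmap (K : comNzRingType) (V W V' W' : lmodType K)
    (f : V -> V') (g : W -> W') : V ⊗ W -> V' ⊗ W' :=
  tlift (fun v w => f v ⊗ g w).

Definition tassoc (K : comNzRingType) (U V W : lmodType K) :
    (U ⊗ V) ⊗ W -> U ⊗ (V ⊗ W) :=
  tlift (fun x w => tlift (fun u v => u ⊗ (v ⊗ w)) x).

Definition tmul (K : comNzRingType) (A B : algType K) (x y : A ⊗ B) : A ⊗ B :=
  tlift (fun a b => tlift (fun a' b' => (a * a') ⊗ (b * b')) y) x.

Section Span.
Variables (K : nzRingType) (V : lmodType K).

Definition lspan (S : set V) : set V :=
  [set v | exists (n : nat) (c : 'I_n -> K) (x : 'I_n -> V),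
     (forall i, S (x i)) /\ v = \sum_(i < n) c i *: x i].

Definition is_basis (S : set V) (n : nat) (b : 'I_n -> V) : Prop :=
  [/\ forall i, S (b i),
      forall c : 'I_n -> K, \sum_(i < n) c i *: b i = 0 -> forall i, c i = 0
    & forall v, S v -> exists c : 'I_n -> K, v = \sum_(i < n) c i *: b i].

(* to be used for linear subspaces S *)
Definition has_dim (S : set V) (n : nat) : Prop :=
  exists b : 'I_n -> V, is_basis S b.

End Span.

(* Below C is the field of complex numbers R[i]; the definitions make sense   *)
(* over any numClosedFieldType.                                               *)

HB.mixin Record Algebra_isStar (C : numClosedFieldType) A
    of GRing.Algebra C A := {
  star : A -> A;
  starK : involutive star;
  starD : {morph star : x y / x + y};
  starZ : forall (c : C) x, star (c *: x) = c^* *: star x;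
  starM : forall x y, star (x * y) = star y * star x
}.

#[short(type="starAlgType")]
HB.structure Definition StarAlgebra (C : numClosedFieldType) :=
  {A of GRing.Algebra C A & Algebra_isStar C A}.

(* The norm takes its values in the nonnegative elements of C, as the norms   *)
(* of numDomainTypes do.                                                      *)
HB.mixin Record StarAlgebra_isCStar (C : numClosedFieldType) A
    of StarAlgebra C A := {
  cnorm : A -> C;
  cnorm0_eq0 : forall x, cnorm x = 0 -> x = 0;
  cnormD : forall x y, cnorm (x + y) <= cnorm x + cnorm y;
  cnormZ : forall (c : C) x, cnorm (c *: x) = `|c| * cnorm x;
  cnormM : forall x y, cnorm (x * y) <= cnorm x * cnorm y;
  cnorm_star : forall x, cnorm (star x * x) = cnorm x ^+ 2;
  cnorm_complete : forall u : nat -> A,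
    (forall eps : C, 0 < eps -> exists N, forall m n,
       (N <= m)%N -> (N <= n)%N -> cnorm (u m - u n) < eps) ->
    exists l, forall eps : C, 0 < eps -> exists N, forall n,
       (N <= n)%N -> cnorm (u n - l) < eps
}.

#[short(type="cstarAlgType")]
HB.structure Definition CStarAlgebra (C : numClosedFieldType) :=
  {A of StarAlgebra C A & StarAlgebra_isCStar C A}.

Definition cdense (C : numClosedFieldType) (A : cstarAlgType C) (S : set A) :
    Prop :=
  forall (x : A) (eps : C), 0 < eps -> exists2 y, S y & cnorm (x - y) < eps.

Definition tstar (C : numClosedFieldType) (A B : starAlgType C) :
    A ⊗ B -> A ⊗ B :=
  tlift (fun a b => star a ⊗ star b).

Definition star_morph (C : numClosedFieldType) (A B : starAlgType C)
    (f : A -> B) : Prop :=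
  forall a, f (star a) = star (f a).

Definition is_state (C : numClosedFieldType) (A : starAlgType C)
    (phi : {scalar A}) : Prop :=
  phi 1 = 1 /\ forall a, 0 <= phi (star a * a).

(* T, with (a, b) |-> t a b, is the minimal (spatial) C*-tensor product of A  *)
(* and B: the completion of the algebraic tensor product for the norm         *)
(*   |x|^2 = sup {(phi (x) psi)(y^* x^* x y)}                                 *)
(* over all states phi of A, psi of B and all y in the algebraic tensor       *)
(* product with (phi (x) psi)(y^* y) <= 1. By the GNS construction this is    *)
(* the supremum of the norms of x in the tensor products of a representation  *)
(* of A and a representation of B.                                            *)
Record spatial_tensor (C : numClosedFieldType) (A B T : cstarAlgType C)
    (t : {bilinear A -> B -> T}) : Prop := {
  spatial_1 : t 1 1 = 1;
  spatial_M : forall a a' b b', t (a * a') (b * b') = t a b * t a' b';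
  spatial_star : forall a b, t (star a) (star b) = star (t a b);
  spatial_dense : cdense (lspan [set x | exists a b, x = t a b]);
  spatial_norm : forall x : A ⊗ B,
    supremums [set r : C | exists (phi : {scalar A}) (psi : {scalar B})
                                  (y : A ⊗ B),
        let phipsi := tlift (fun a b => phi a * psi b) in
        [/\ is_state phi, is_state psi, phipsi (tmul (tstar y) y) <= 1
          & r = phipsi (tmul (tstar (tmul x y)) (tmul x y))] ]
      (cnorm (tlift t x) ^+ 2)
}.

Section CompactQuantumGroup.
Variable C : numClosedFieldType.

(* Compact quantum groups in the sense of Woronowicz. cqg_T2 and cqg_T3 are   *)
(* the C*-algebras A (x) A and A (x) A (x) A; the latter is presented both as *)
(* (A (x) A) (x) A and as A (x) (A (x) A). The *-homomorphisms cqg_Delta_id   *)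
(* and cqg_id_Delta are determined by their values on elementary tensors.     *)
Record cqg := CQG {
  cqg_alg :> cstarAlgType C;
  cqg_T2 : cstarAlgType C;
  cqg_T3 : cstarAlgType C;
  cqg_t : {bilinear cqg_alg -> cqg_alg -> cqg_T2};
  cqg_tl : {bilinear cqg_T2 -> cqg_alg -> cqg_T3};
  cqg_tr : {bilinear cqg_alg -> cqg_T2 -> cqg_T3};
  cqg_tP : spatial_tensor cqg_t;
  cqg_tlP : spatial_tensor cqg_tl;
  cqg_trP : spatial_tensor cqg_tr;
  cqg_tA : forall a b c, cqg_tl (cqg_t a b) c = cqg_tr a (cqg_t b c);
  cqg_Delta : {lrmorphism cqg_alg -> cqg_T2};
  cqg_Delta_star : star_morph cqg_Delta;
  cqg_Delta_id : {lrmorphism cqg_T2 -> cqg_T3};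
  cqg_Delta_id_star : star_morph cqg_Delta_id;
  cqg_Delta_idE : forall a b,
    cqg_Delta_id (cqg_t a b) = cqg_tl (cqg_Delta a) b;
  cqg_id_Delta : {lrmorphism cqg_T2 -> cqg_T3};
  cqg_id_Delta_star : star_morph cqg_id_Delta;
  cqg_id_DeltaE : forall a b,
    cqg_id_Delta (cqg_t a b) = cqg_tr a (cqg_Delta b);
  cqg_coassoc : forall a,
    cqg_Delta_id (cqg_Delta a) = cqg_id_Delta (cqg_Delta a);
  cqg_density_l :
    cdense (lspan [set x | exists a b, x = cqg_t b 1 * cqg_Delta a]);
  cqg_density_r :
    cdense (lspan [set x | exists a b, x = cqg_t 1 b * cqg_Delta a])
}.

Definition mxstar (A : starAlgType C) m n (u : 'M[A]_(m, n)) : 'M[A]_(n, m) :=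
  \matrix_(i, j) star (u j i).

Definition mx_in (A : algType C) m n (P : 'M[C]_(m, n)) : 'M[A]_(m, n) :=
  map_mx (in_alg A) P.

Variable G : cqg.

(* The element u of B(C^n) (x) A is given by its matrix elements. *)
Definition unitary_rep n (u : 'M[G]_n) : Prop :=
  [/\ forall i j, cqg_Delta G (u i j) = \sum_(k < n) cqg_t G (u i k) (u k j),
      mxstar u *m u = 1%:M & u *m mxstar u = 1%:M].

(* The range of the idempotent P is invariant under u iff                     *)
(* (P (x) 1) u (P (x) 1) = u (P (x) 1).                                      *)
Definition irreducible_rep n (u : 'M[G]_n) : Prop :=
  (0 < n)%N /\
  forall P : 'M[C]_n, P *m P = P ->
    mx_in G P *m u *m mx_in G P = u *m mx_in G P -> P = 0 \/ P = 1%:M.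

Definition equivalent_rep m n (u : 'M[G]_m) (v : 'M[G]_n) : Prop :=
  exists (S : 'M[C]_(m, n)) (S' : 'M[C]_(n, m)),
    [/\ S *m S' = 1%:M, S' *m S = 1%:M & u *m mx_in G S = mx_in G S *m v].

Definition irr_unitary_rep n (u : 'M[G]_n) : Prop :=
  unitary_rep u /\ irreducible_rep u.

End CompactQuantumGroup.

Section HopfStarAlgebra.
Variable C : numClosedFieldType.

Record hopfStarAlg := HopfStarAlg {
  hopf_alg :> starAlgType C;
  Delta : {linear hopf_alg -> (hopf_alg ⊗ hopf_alg)%type};
  counit : {scalar hopf_alg};
  antipode : {linear hopf_alg -> hopf_alg};
  Delta1 : Delta 1 = 1 ⊗ 1;
  DeltaM : forall a b, Delta (a * b) = tmul (Delta a) (Delta b);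
  Delta_star : forall a, Delta (star a) = tstar (Delta a);
  Delta_coassoc : forall a,
    tassoc (tmap Delta idfun (Delta a)) = tmap idfun Delta (Delta a);
  counit1 : counit 1 = 1;
  counitM : forall a b, counit (a * b) = counit a * counit b;
  counitl : forall a, tlift (fun a1 a2 => counit a1 *: a2) (Delta a) = a;
  counitr : forall a, tlift (fun a1 a2 => counit a2 *: a1) (Delta a) = a;
  antipodel : forall a,
    tlift (fun a1 a2 => antipode a1 * a2) (Delta a) = counit a *: 1;
  antipoder : forall a,
    tlift (fun a1 a2 => a1 * antipode a2) (Delta a) = counit a *: 1
}.

Variable A : hopfStarAlg.

Definition is_haar (h : {scalar A}) : Prop :=
  [/\ h 1 = 1,
      forall a, tlift (fun a1 a2 => h a2 *: a1) (Delta A a) = h a *: 1,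
      forall a, tlift (fun a1 a2 => h a1 *: a2) (Delta A a) = h a *: 1
    & forall a, a != 0 -> 0 < h (star a * a)].

Definition conv (chi : A -> C) (a : A) : A :=
  tlift (fun a1 a2 => chi a2 *: a1) (Delta A a).

Definition fmul (f g : A -> C) (a : A) : C :=
  tlift (fun a1 a2 => f a1 * g a2) (Delta A a).

Definition fstar (chi : A -> C) (a : A) : C := (chi (star (antipode A a)))^*.

(* A is the Hopf *-algebra associated with G, identified by iota with a       *)
(* *-subalgebra of the C*-algebra of G.                                       *)
Record associated_hopf (G : cqg C) (iota : {lrmorphism A -> G}) : Prop := {
  assoc_star : star_morph iota;
  assoc_inj : injective iota;
  assoc_range : range iota =
    lspan [set x | exists (n : nat) (u : 'M[G]_n) (i j : 'I_n),
                     irr_unitary_rep u /\ x = u i j];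
  assoc_Delta : forall a,
    cqg_Delta G (iota a) = tlift (fun a1 a2 => cqg_t G (iota a1) (iota a2))
                                 (Delta A a)
}.

(* The first clause is the same identity as the one contained in unitary_rep, *)
(* but in the algebraic tensor product.                                       *)
Definition complete_irr_family (G : cqg C) (iota : A -> G) (I : Type)
    (n : I -> nat) (U : forall al, 'M[A]_(n al)) : Prop :=
  [/\ forall al i j,
        Delta A (U al i j) = \sum_(k < n al) U al i k ⊗ U al k j,
      forall al, irr_unitary_rep (map_mx iota (U al)),
      forall al be, al <> be ->
        ~ equivalent_rep (map_mx iota (U al)) (map_mx iota (U be))
    & forall m (u : 'M[G]_m), irr_unitary_rep u ->
        exists al, equivalent_rep u (map_mx iota (U al))].

End HopfStarAlgebra.

Section DifferentialCalculus.
Variable C : numClosedFieldType.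

Record gradedStarAlg := GradedStarAlg {
  gr_alg :> algType C;
  gr : nat -> set gr_alg;
  gr_star : gr_alg -> gr_alg;
  gr0 : forall k, gr k 0;
  grP : forall k (c : C) x y, gr k x -> gr k y -> gr k (c *: x + y);
  gr_sum : forall x, exists (n : nat) (f : 'I_n -> gr_alg),
    (forall k : 'I_n, gr k (f k)) /\ x = \sum_(k < n) f k;
  gr_direct : forall (n : nat) (f : 'I_n -> gr_alg),
    (forall k : 'I_n, gr k (f k)) -> \sum_(k < n) f k = 0 ->
    forall k, f k = 0;
  grM : forall k l x y, gr k x -> gr l y -> gr (k + l)%N (x * y);
  gr_starD : {morph gr_star : x y / x + y};
  gr_starZ : forall (c : C) x, gr_star (c *: x) = c^* *: gr_star x;
  gr_star_deg : forall k x, gr k x -> gr k (gr_star x);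
  gr_starK : involutive gr_star;
  gr_starM : forall k l x y, gr k x -> gr l y ->
    gr_star (x * y) = (- 1) ^+ (k * l) *: (gr_star y * gr_star x)
}.

Record gradedStarDiffAlg := GradedStarDiffAlg {
  gd_alg :> gradedStarAlg;
  dif : {linear gd_alg -> gd_alg};
  dif_deg : forall k x, gr k x -> gr k.+1 (dif x);
  dif_dif : forall x, dif (dif x) = 0;
  dif_star : forall x, dif (gr_star x) = gr_star (dif x);
  dif_leibniz : forall k x y, gr k x ->
    dif (x * y) = dif x * y + (- 1) ^+ k *: (x * dif y)
}.

(* dc_in identifies A with the degree 0 part. *)
Record starDiffCalculus (A : hopfStarAlg C) := StarDiffCalculus {
  dc_alg :> gradedStarDiffAlg;
  dc_in : {lrmorphism A -> dc_alg};
  dc_Delta : {linear dc_alg -> (A ⊗ dc_alg)%type};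
  dc_in_inj : injective dc_in;
  dc_in_star : forall a, dc_in (star a) = gr_star (dc_in a);
  dc_deg0 : @gr dc_alg 0 = range dc_in;
  dc_deg : forall k, (0 < k)%N ->
    @gr dc_alg k =
      lspan [set x | exists (a0 : A) (a : 'I_k -> A),
               x = dc_in a0 * \prod_(i < k) dif dc_alg (dc_in (a i))];
  dc_Delta1 : dc_Delta 1 = 1 ⊗ 1;
  dc_DeltaM : forall x y, dc_Delta (x * y) = tmul (dc_Delta x) (dc_Delta y);
  dc_Delta_in : forall a, dc_Delta (dc_in a) = tmap idfun dc_in (Delta A a);
  dc_Delta_dif : forall x,
    tmap idfun (dif dc_alg) (dc_Delta x) = dc_Delta (dif dc_alg x);
  dc_dif1 : dif dc_alg 1 = 0
}.

Variables (A : hopfStarAlg C) (Om : starDiffCalculus A).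

Definition inv_forms : set Om := [set x | dc_Delta Om x = 1 ⊗ x].

Definition inv_forms_deg (k : nat) : set Om := gr k `&` inv_forms.

Definition strongly_finite_dim : Prop := exists n, has_dim inv_forms n.

Definition calculus_dim (N : nat) : Prop :=
  (exists2 x : Om, gr N x & x <> 0) /\
  forall k, (N < k)%N -> forall x : Om, gr k x -> x = 0.

(* {dot Om for Num.conj}: positive definite Hermitian forms, linear in the    *)
(* first variable.                                                            *)
Definition graded_ip (ip : {dot Om for (@Num.conj C)}) : Prop :=
  forall k l (x y : Om), k <> l -> gr k x -> gr l y -> ip x y = 0.

Definition left_invariant_ip (h : {scalar A})
    (ip : {dot Om for (@Num.conj C)}) : Prop :=
  ip 1 1 = 1 /\
  forall (a b : A) (x y : Om), inv_forms x -> inv_forms y ->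
    ip (dc_in Om a * x) (dc_in Om b * y) = h (star b * a) * ip x y.

Definition is_adjoint (ip : {dot Om for (@Num.conj C)}) (D Ds : Om -> Om) :
    Prop :=
  forall x y, ip (D x) y = ip x (Ds y).

Definition laplacian (Ds : Om -> Om) : Om -> Om :=
  let D x := dif Om x + Ds x in D \o D.

End DifferentialCalculus.

Section MatrixElements.
Variable C : numClosedFieldType.

Definition orthonormal_basis n (e : 'I_n -> 'cV[C]_n) : Prop :=
  forall i j, \sum_(k < n) e i k 0 * (e j k 0)^* = (i == j)%:R.

(* The matrix elements of u in B(C^n) (x) A relative to the orthonormal basis *)
(* e: u (e_j (x) 1) = sum_i e_i (x) u_ij.                                     *)
Definition matrix_element (A : algType C) n (u : 'M[A]_n)
    (e : 'I_n -> 'cV[C]_n) (i j : 'I_n) : A :=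
  \sum_(k < n) \sum_(l < n) ((e i k 0)^* * e j l 0) *: u k l.

End MatrixElements.

(* Main.v *)
(* On functions d^* vanishes, since the inner product is graded, so the         *)
(* Laplacian of a is d^*(da). By left invariance (db | da) is the sum over r of *)
(* h((chi_r * a)^* (chi_r * b)), and strong left invariance of the Haar         *)
(* integral makes chi_r^* * _ the adjoint of chi_r * _ for h(b^* a). Hence the  *)
(* Laplacian of a is chi * a, and chi * U_ij = sum_k chi(U_kj) U_ik is          *)
(* lambda_j U_ij in an eigenbasis of T.                                         *)

Require Import Defs.
From HB Require Import structures.
From mathcomp Require Import all_boot all_order all_algebra.
From mathcomp Require Import generic_quotient sesquilinear complex.
From mathcomp Require Import boolp classical_sets reals.

Set Implicit Arguments.
Unset Strict Implicit.
Unset Printing Implicit Defensive.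

Import Order.TTheory GRing.Theory Num.Theory.
Local Open Scope ring_scope.

(** In Sweedler notation the key identity is sum h(a1^* b) S(a2)^* = sum h(a^* b1) b2, which is
    [haar_strong_invariance]. Applying a functional [f] to it shows that convolution by [fstar f] is
    adjoint to convolution by [f] ([haar_conv_adjoint]). Pairing d^* da with functions then
    identifies the Laplacian on functions as a convolution ([laplacian_dc_in]). On matrix elements
    this convolution acts through T on the column index alone, which gives lambda_j
    ([conv_matrix_element]). *)

Section TensorLift.

(** * Calculus of maps induced on tensor products *)

Variables (K : comNzRingType) (V W : lmodType K) (X : zmodType).
Implicit Types (f : V -> W -> X) (x y : (V ⊗ W)%type).

Lemma eq_tlift f f' x : (forall v w, f v w = f' v w) -> tlift f x = tlift f' x.
Proof. by move=> ff'; apply: eq_bigr. Qed.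

Lemma raddf_tlift (Y : zmodType) (k : {additive X -> Y}) f x :
  k (tlift f x) = tlift (fun v w => k (f v w)) x.
Proof. by rewrite [LHS]raddf_sum. Qed.

Lemma tliftB f x y : balanced f -> tlift f (x - y) = tlift f x - tlift f y.
Proof.
by move=> bf; apply/eqP; rewrite eq_sym subr_eq -tlift_add // subrK.
Qed.

Lemma tlift_sum f (I : Type) (r : seq I) (E : I -> (V ⊗ W)%type) :
  balanced f -> tlift f (\sum_(i <- r) E i) = \sum_(i <- r) tlift f (E i).
Proof.
move=> bf; apply: (big_morph (tlift f)) => [x y|]; first exact: tlift_add.
exact: tlift_zero.
Qed.

Lemma tlift_tlift (V' W' : lmodType K) f (g : V' -> W' -> (V ⊗ W)%type)
    (x : (V' ⊗ W')%type) : balanced f -> tlift f (tlift g x) = tlift (fun v w => tlift f (g v w)) x.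
Proof. by move=> bf; rewrite [LHS]tlift_sum. Qed.

Lemma tliftBf f f' x :
  tlift (fun v w => f v w - f' v w) x = tlift f x - tlift f' x.
Proof. exact: sumrB. Qed.

Lemma tlift_balancedZ f c x :
  balanced f -> tlift (fun v w => f (c *: v) w) x = tlift f (c *: x).
Proof. by move=> bf; rewrite [RHS]tlift_scale. Qed.

(** [tlift] is a finite sum over one fixed representative of [x], and the identities defining
    balancedness survive finite sums. *)
Lemma balanced_tlift (V' W' : lmodType K) (F : V' -> W' -> V -> W -> X) x :
  (forall v w, balanced (fun v' w' => F v' w' v w)) ->
  balanced (fun v' w' => tlift (F v' w') x).
Proof.
move=> bF; split=> [w' u v|v' u v|a v' w']; rewrite -?tliftBf;
  apply: eq_tlift => v0 w0; have [Fl Fr Fb] := bF v0 w0.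
- exact: Fl.
- exact: Fr.
- exact: Fb.
Qed.

End TensorLift.

(** * Convolution of functionals and invariance of the Haar integral *)

Section HopfAlgebra.
Variables (C : numClosedFieldType) (A : hopfStarAlg C).
Implicit Types (a b c : A) (f g : {scalar A}).

Lemma star_is_zmod_morphism (B : starAlgType C) : zmod_morphism (@star C B).
Proof. by move=> x y; apply/eqP; rewrite eq_sym subr_eq -starD subrK. Qed.

HB.instance Definition _ (B : starAlgType C) :=
  GRing.isZmodMorphism.Build B B (@star C B) (@star_is_zmod_morphism B).

Lemma star1 (B : starAlgType C) : star 1 = 1 :> B.
Proof. by rewrite -[LHS]mul1r -[X in X * _]starK -starM mul1r starK. Qed.

Lemma fstar_is_linear f : scalar (fstar f).
Proof.
move=> c a b; rewrite /fstar.
by rewrite linearP starD starZ linearP rmorphD rmorphM /= conjCK.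
Qed.

HB.instance Definition _ f :=
  GRing.isLinear.Build C A C _ (fstar f) (fstar_is_linear f).

(** This justifies writing a1, a2, a3 for the iterated coproduct: the map induced by [F] on the
    triple tensor product is applied to both sides of coassociativity. *)
Lemma tlift_coassoc (X : zmodType) (F : A -> A -> A -> X) a :
  (forall z, balanced (fun x y => F x y z)) -> (forall x, balanced (F x)) ->
  tlift (fun a1 a2 => tlift (fun u v => F u v a2) (Delta A a1)) (Delta A a) =
  tlift (fun a1 a2 => tlift (F a1) (Delta A a2)) (Delta A a).
Proof.
move=> bl br.
have br' : balanced (fun u => tlift (F u)).
  split=> [y u v|u y z|c u y].
  - rewrite -tliftBf; apply: eq_tlift => v' w'.
    by have [Fl _ _] := bl w'; apply: Fl.
  - exact: tliftB.
  - rewrite -tlift_balancedZ //; apply: eq_tlift => v' w'.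
    by have [_ _ Fb] := bl w'; apply: Fb.
have bl' : balanced (fun y w => tlift (fun u v => F u v w) y).
  split=> [w x y|y w w'|c y w].
  - exact: tliftB.
  - rewrite -tliftBf; apply: eq_tlift => u v.
    by have [_ Fr _] := br u; apply: Fr.
  - rewrite -tlift_balancedZ //; apply: eq_tlift => u v.
    (* The scalar travels from the first slot to the third through the middle one. *)
    have [_ _ Fb] := bl w; have [_ _ Fb'] := br u.
    by rewrite Fb Fb'.
have /(congr1 (tlift (fun u => tlift (F u)))) := Delta_coassoc a.
rewrite /tassoc tlift_tlift //.
under eq_tlift => x w.
  rewrite tlift_tlift //.
  under eq_tlift => u v do rewrite !tlift_tens //.
over.
rewrite /tmap !tlift_tlift //.
under eq_tlift => x w do rewrite tlift_tens //=.
by under [RHS]eq_tlift => x w do rewrite tlift_tens //=.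
Qed.

Lemma balanced_conv f : balanced (fun a1 a2 : A => f a2 *: a1).
Proof.
split=> [w u v|v w w'|c v w]; first by rewrite scalerBr.
  by rewrite raddfB scalerBl.
by rewrite scalerA linearZ /= mulrC.
Qed.

Lemma balanced_convl f : balanced (fun a1 a2 : A => f a1 *: a2).
Proof.
split=> [w u v|v w w'|c v w]; last by rewrite scalerA linearZ /= mulrC.
  by rewrite raddfB scalerBl.
by rewrite scalerBr.
Qed.

Lemma balanced_fmul f g : balanced (fun a1 a2 : A => f a1 * g a2).
Proof.
split=> [w u v|v w w'|c v w]; last by rewrite !linearZ /= mulrCA mulrA.
  by rewrite raddfB mulrBl.
by rewrite raddfB mulrBr.
Qed.

Lemma fmul_is_linear f g : scalar (fmul f g).
Proof.
move=> c a b; have bfg := balanced_fmul f g.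
rewrite /fmul linearP tlift_add // -tlift_balancedZ //.
congr (_ + _); rewrite [RHS](raddf_tlift (c \*o idfun)).
by apply: eq_tlift => v w; rewrite /= linearZ mulrA.
Qed.

HB.instance Definition _ f g :=
  GRing.isLinear.Build C A C _ (fmul f g) (fmul_is_linear f g).

Lemma conv_is_linear f : linear (conv f).
Proof.
move=> c a b; have bf := balanced_conv f.
rewrite /conv linearP tlift_add // -tlift_balancedZ //.
congr (_ + _); rewrite [RHS](raddf_tlift ( *:%R c)).
by apply: eq_tlift => v w; rewrite /= !scalerA mulrC.
Qed.

HB.instance Definition _ f :=
  GRing.isLinear.Build C A A _ (conv f) (conv_is_linear f).

(** By coassociativity both sides are the sum of f(a2) g(a3) a1. *)
Lemma conv_fmul f g a : conv (fmul f g) a = conv f (conv g a).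
Proof.
rewrite [conv g a]/conv [RHS](raddf_tlift (conv f)).
transitivity (tlift (fun a1 a2 =>
    tlift (fun u v => (f v * g a2) *: u) (Delta A a1)) (Delta A a)); last first.
  apply: eq_tlift => a1 a2; rewrite /= linearZ /conv [RHS](raddf_tlift ( *:%R _)).
  by apply: eq_tlift => u v; rewrite /= scalerA mulrC.
rewrite (tlift_coassoc (F := fun u v w => (f v * g w) *: u)).
- by apply: eq_tlift => u v; rewrite /fmul /tlift /fsum scaler_suml.
- move=> z; split=> [w u v|v w w'|c v w]; first by rewrite scalerBr.
    by rewrite raddfB mulrBl scalerBl.
  by rewrite scalerA linearZ /= mulrC mulrA.
- move=> x; split=> [w u v|v w w'|c v w].
  + by rewrite raddfB mulrBl scalerBl.
  + by rewrite raddfB mulrBr scalerBl.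
  + by rewrite !linearZ /= mulrCA mulrA.
Qed.

Lemma conv_sum (J : Type) (r : seq J) (F : J -> A -> C) a :
  conv (fun x => \sum_(j <- r) F j x) a = \sum_(j <- r) conv (F j) a.
Proof.
rewrite /conv /tlift /fsum exchange_big /=.
by apply: eq_bigr => p _; rewrite scaler_suml.
Qed.

Lemma tlift_star_mul (X : zmodType) (f : A -> A -> X) a b : balanced f ->
  tlift f (Delta A (star a * b)) =
  tlift (fun a1 a2 => tlift (fun b1 b2 => f (star a1 * b1) (star a2 * b2))
                            (Delta A b)) (Delta A a).
Proof.
move=> bf; have [fl fr fb] := bf.
rewrite DeltaM Delta_star /tmul tlift_tlift //.
under eq_tlift => u v.
  rewrite tlift_tlift //.
  under eq_tlift => b1 b2 do rewrite tlift_tens //.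
over.
rewrite /tstar tlift_tlift; last first.
  apply: balanced_tlift => v w; split=> [w' u u'|v' u u'|c u u'].
  - by rewrite mulrBl; apply: fl.
  - by rewrite mulrBl; apply: fr.
  - by rewrite -!scalerAl; apply: fb.
apply: eq_tlift => u v; rewrite tlift_tens //.
apply: balanced_tlift => v' w; split=> [w' x y|x y z|c x y].
- by rewrite mulrBl; apply: fl.
- by rewrite mulrBl; apply: fr.
- by rewrite -!scalerAl; apply: fb.
Qed.

Variable h : {scalar A}.
Hypothesis hh : is_haar h.

(* Next to S(a2)^*, expand h(a1^* b) 1 as h(a1^* b1) a2^* b2: after            *)
(* coassociativity, S(a3)^* a2^* = (a2 S(a3))^* collapses to the counit.       *)
Lemma haar_strong_invariance a b :
  tlift (fun a1 a2 => h (star a1 * b) *: star (antipode A a2)) (Delta A a) =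
  tlift (fun b1 b2 => h (star a * b1) *: b2) (Delta A b).
Proof.
have [_ _ hl _] := hh.
have starB (x y : A) : star (x - y) = star x - star y by apply: raddfB.
pose F x y z := tlift (fun b1 b2 =>
  h (star x * b1) *: (star (antipode A z) * star y * b2)) (Delta A b).
transitivity (tlift (fun a1 a2 =>
    tlift (fun u v => F u v a2) (Delta A a1)) (Delta A a)).
  apply: eq_tlift => a1 a2.
  rewrite -[star (antipode A a2)]mulr1 scalerAr -hl.
  rewrite tlift_star_mul; last exact: balanced_convl.
  rewrite [LHS](raddf_tlift (_ \*o idfun)); apply: eq_tlift => u v.
  rewrite [LHS](raddf_tlift (_ \*o idfun)); apply: eq_tlift => b1 b2.
  by rewrite /= -scalerAr mulrA.
rewrite tlift_coassoc; last first.
- move=> x; apply: balanced_tlift => v w; split=> [z y y'|y z z'|c y z].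
  + by rewrite starB mulrBr mulrBl scalerBr.
  + by rewrite raddfB starB !mulrBl scalerBr.
  + by rewrite linearZ /= !starZ -scalerAr -!scalerAl.
- move=> z; apply: balanced_tlift => v w; split=> [y x x'|x y y'|c x y].
  + by rewrite starB mulrBl raddfB scalerBl.
  + by rewrite starB mulrBr mulrBl scalerBr.
  + by rewrite !starZ -scalerAr -!scalerAl linearZ /= !scalerA mulrC.
(* The counit is placed next to [a1], inside the star, so that the outer sum reassembles [a] by
   [counitr]. *)
transitivity (tlift (fun a1 a2 => tlift (fun b1 b2 =>
    h (star (counit A a2 *: a1) * b1) *: b2) (Delta A b)) (Delta A a)).
  apply: eq_tlift => a1 a2; rewrite /F /tlift /fsum exchange_big /=.
  apply: eq_bigr => p _; rewrite -scaler_sumr -mulr_suml.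
  under eq_bigr => i _ do rewrite -starM.
  rewrite -(raddf_sum star) /=.
  have := antipoder a2; rewrite /tlift /fsum => ->.
  by rewrite !starZ star1 -!scalerAl mul1r scalerA linearZ /= mulrC.
rewrite -[in RHS](counitr a) /tlift /fsum exchange_big /=; apply: eq_bigr => p _.
by rewrite (raddf_sum star) mulr_suml (raddf_sum h) scaler_suml.
Qed.

(** Apply [f] to strong invariance; the conjugation in [fstar] is undone when the scalar leaves the
    star in the first argument of the product. *)
Lemma haar_conv_adjoint f a b :
  h (star a * conv f b) = h (star (conv (fstar f) a) * b).
Proof.
have := congr1 f (haar_strong_invariance a b).
rewrite !raddf_tlift /= /conv => /esym e.
transitivity (tlift (fun b1 b2 => f (h (star a * b1) *: b2)) (Delta A b)).
  rewrite [LHS](raddf_tlift (h \o (star a \*o idfun))); apply: eq_tlift => v w.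
  by rewrite /= -scalerAr !linearZ /= mulrC.
rewrite e /tlift /fsum mulr_suml raddf_sum.
by apply: eq_bigr => p _; rewrite /fstar starZ conjCK -scalerAl [LHS]linearZ [RHS]linearZ /= mulrC.
Qed.

End HopfAlgebra.

(** * The Laplacian on functions *)

Section Laplacian.
Variables (C : numClosedFieldType) (A : hopfStarAlg C) (h : {scalar A}).
Hypothesis hh : is_haar h.
Variables (Om : starDiffCalculus A) (ip : {dot Om for (@Num.conj C)}).
Hypotheses (hgr : graded_ip ip) (hinv : left_invariant_ip h ip).

(** By definiteness it suffices to test [y - z] against itself, and its homogeneous components
    reduce this to homogeneous test forms. *)
Lemma graded_ip_inj (y z : Om) :
  (forall k x, gr k x -> ip x y = ip x z) -> y = z.
Proof.
move=> yz; apply/eqP; rewrite -subr_eq0 -(dnorm_eq0 ip) linearBr subr_eq0.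
have [m [f [fk ->]]] := gr_sum (y - z); rewrite !linear_sumlz.
by apply/eqP; apply: eq_bigr => k _; apply: yz (fk k).
Qed.

Lemma gr_dc_in (a : A) : @gr _ Om 0 (dc_in Om a).
Proof. by rewrite dc_deg0; exists a. Qed.

Lemma ip_dc_in (a b : A) : ip (dc_in Om a) (dc_in Om b) = h (star b * a).
Proof.
have [ip1 ipM] := hinv.
have inv1 : inv_forms (1 : Om) by apply: dc_Delta1.
by rewrite -[dc_in Om a]mulr1 -[dc_in Om b]mulr1 ipM // ip1 mulr1.
Qed.

Variable (Ds : {linear Om -> Om}).
Hypothesis hDs : is_adjoint ip (dif Om) Ds.

(** Pairing with d^* a amounts to pairing some dx, of positive degree, with a function. *)
Lemma codif_dc_in (a : A) : Ds (dc_in Om a) = 0.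
Proof.
apply: graded_ip_inj => k x kx; rewrite linear0r -hDs.
by apply: hgr (dif_deg kx) (gr_dc_in a).
Qed.

Variables (M : nat) (om : 'I_M -> Om).
Hypothesis inv_om : forall r, inv_forms (om r).
Hypothesis horth : forall r s, ip (om r) (om s) = (r == s)%:R.
Variable chi : 'I_M -> {scalar A}.
Hypothesis hchi : forall a : A,
  dif Om (dc_in Om a) = \sum_(r < M) dc_in Om (conv (chi r) a) * om r.

Lemma laplacian_dc_in (a : A) : laplacian Ds (dc_in Om a) =
  dc_in Om (conv (fun x => \sum_(r < M) fmul (fstar (chi r)) (chi r) x) a).
Proof.
have [_ ipM] := hinv.
rewrite /laplacian /= codif_dc_in addr0 dif_dif add0r.
apply: graded_ip_inj => k x kx; rewrite -hDs.
(* For a test form of degree k > 0 both pairings vanish: degrees k+1 and 1 differ, as do k and 0. *)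
have [k0|k0] := eqVneq k 0%N; last first.
  rewrite (hgr _ kx (gr_dc_in _)); last exact/eqP.
  by apply: hgr (dif_deg kx) (dif_deg (gr_dc_in _)); case; apply/eqP.
move: kx; rewrite k0 dc_deg0 => -[b _ <-].
rewrite ip_dc_in !hchi linear_sumlz conv_sum (raddf_sum star) mulr_suml raddf_sum.
(* Orthonormality of the [om] leaves only s = r in the double sum for (db | da). *)
apply: eq_bigr => r _; rewrite linear_sumr (bigD1 r) //= big1 => [|s sr].
  rewrite ipM // horth eqxx mulr1 addr0 conv_fmul.
  exact: haar_conv_adjoint.
by rewrite ipM // horth eq_sym (negPf sr) mulr0.
Qed.

End Laplacian.

(** * Convolution on matrix elements *)

Section MatrixElementConv.
Variables (C : numClosedFieldType) (A : hopfStarAlg C).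

Lemma conv_matrix_element (f : {scalar A}) n (u : 'M[A]_n)
    (e : 'I_n -> 'cV[C]_n) (lam : 'I_n -> C) :
  (forall i j, Delta A (u i j) = \sum_(k < n) u i k ⊗ u k j) ->
  (forall i, map_mx f u *m e i = lam i *: e i) ->
  forall i j, conv f (matrix_element u e i j) = lam j *: matrix_element u e i j.
Proof.
move=> Du eig i j.
have conv_u k l : conv f (u k l) = \sum_(m < n) f (u m l) *: u k m.
  rewrite /conv Du tlift_sum; last exact: balanced_conv.
  by apply: eq_bigr => m _; rewrite tlift_tens //; apply: balanced_conv.
rewrite /matrix_element raddf_sum scaler_sumr; apply: eq_bigr => k _.
rewrite raddf_sum scaler_sumr.
under eq_bigr => l _ do rewrite /= linearZ /= conv_u scaler_sumr.
(* With m outermost, the sum over l is coordinate m of T e_j, to which the eigenvector equation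
   applies. *)
rewrite exchange_big /=; apply: eq_bigr => m _.
have /matrixP/(_ m 0) := eig j; rewrite !mxE => eig_m.
rewrite scalerA mulrCA -eig_m mulr_sumr scaler_suml; apply: eq_bigr => l _.
by rewrite !mxE scalerA -mulrA [f _ * _]mulrC.
Qed.

End MatrixElementConv.

Theorem theorem5p3 (R : realType) (G : cqg R[i]) (A : hopfStarAlg R[i])
    (iota : {lrmorphism A -> G}) (hA : associated_hopf iota)
    (h : {scalar A}) (hh : is_haar h)
    (Om : starDiffCalculus A) (N : nat)
    (hfin : strongly_finite_dim Om) (hN : calculus_dim Om N)
    (hvol : has_dim (@inv_forms_deg _ _ Om N) 1)
    (hclosed : forall (k : nat) (w : Om), k.+1 = N ->
       inv_forms_deg k w -> dif Om w = 0)
    (ip : {dot Om for (@Num.conj R[i])})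
    (hgr : graded_ip ip) (hinv : left_invariant_ip h ip)
    (Ds : {linear Om -> Om}) (hDs : is_adjoint ip (dif Om) Ds)
    (M : nat) (om : 'I_M -> Om)
    (hbasis : is_basis (@inv_forms_deg _ _ Om 1) om)
    (horth : forall r s, ip (om r) (om s) = (r == s)%:R)
    (chi : 'I_M -> {scalar A})
    (hchi : forall a : A,
       dif Om (dc_in Om a) =
         \sum_(r < M) dc_in Om (conv (chi r) a) * om r)
    (I : Type) (n : I -> nat) (U : forall al, 'M[A]_(n al))
    (hU : complete_irr_family iota U)
    (e : forall al, 'I_(n al) -> 'cV[R[i]]_(n al))
    (he : forall al, orthonormal_basis (e al))
    (lam : forall al, 'I_(n al) -> R[i]) :
  let chi_tot := fun a : A => \sum_(r < M) fmul (fstar (chi r)) (chi r) a in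
  let T := fun al => map_mx chi_tot (U al) in
  (forall al i, T al *m e al i = lam al i *: e al i) ->
  forall al i j,
    laplacian Ds (dc_in Om (matrix_element (U al) (e al) i j)) =
      lam al j *: dc_in Om (matrix_element (U al) (e al) i j).
Proof.
move=> chi_tot T eig al i j; have [_ _ _ hl] := hh; have [Du _ _ _] := hU.
have chi_tot_linear : scalar chi_tot.
  move=> c a b; rewrite /chi_tot mulr_sumr -big_split /=.
  by apply: eq_bigr => r _; rewrite linearP.
(* [chi_tot] is a bare function; [conv_matrix_element] expects a bundled linear form. *)
pose f : {scalar A} := HB.pack chi_tot
  (GRing.isLinear.Build R[i] A R[i] _ chi_tot chi_tot_linear).
have inv_om r : inv_forms (om r) by have [om_in _ _] := hbasis; case: (om_in r).
rewrite (laplacian_dc_in hh hgr hinv hDs inv_om horth hchi) -[conv _ _]/(conv f _).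
by rewrite (conv_matrix_element (f := f) (Du al) (eig al)) linearZ.
Qed.
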